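(* Let $\dim\mathcal{H}=2$ and let $\mathcal{N}\in T$, i.e. $\mathcal{N}$ is a unital TPCP map on $\mathcal{L}(\mathcal{H})$ of the form $\mathcal{N}(1)=1$, $\mathcal{N}(\sigma_i)=d^i\sigma_i$ ($i=1,2,3$) with $(d^1,d^2,d^3)$ in the tetrahedron $T\subset\mathbb{R}^3$ with vertices $(1,1,1)$, $(1,-1,-1)$, $(-1,1,-1)$, $(-1,-1,1)$. (i) If $\mathcal{N}\in T_\mu$ for some $\mu\in\{0,1,2,3\}$, then the one-outcome (``no measurement'') ex-ante-ex-post control protocol $$\{(\mathcal{I}_1,\mathcal{C}_1)\},\qquad \mathcal{I}_1=\mathrm{id},\quad \mathcal{C}_1(\rho)=\sigma_\mu\,\rho\,\sigma_\mu,$$ is optimal for $\mathcal{N}$, and the optimal average fidelity is $$\frac12+\frac{|d^1|+|d^2|+|d^3|}{6}.$$ (ii) If $\mathcal{N}\in O$, then for every orthonormal basis $\{|\phi_1\rangle,|\phi_2\rangle\}$ of $\mathcal{H}$ the ``discriminate and reprepare'' protocol $\{(\mathcal{I}_\omega,\mathcal{C}_\omega)\}_{\omega=1,2}$ given by $$\mathcal{I}_\omega(\rho)=|\phi_\omega\rangle\langle\phi_\omega|\,\rho\,|\phi_\omega\rangle\langle\phi_\omega|,\qquad \mathcal{C}_\omega(\rho)=|\phi_\omega\rangle\langle\phi_\omega|\operatorname{Tr}\rho$$ is optimal for $\mathcal{N}$, and the optimal average fidelity is $2/3$.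
   Context: $\mathcal{L}(\mathcal{H})$ is the space of linear operators on the finite-dimensional complex Hilbert space $\mathcal{H}$, and $\mathrm{id}$ is the identity map on $\mathcal{L}(\mathcal{H})$. TPCP means trace-preserving and completely positive; a linear map $\mathcal{E}$ on $\mathcal{L}(\mathcal{H})$ is unital if $\mathcal{E}(1)=1$. A noise process is a TPCP map $\mathcal{N}:\mathcal{L}(\mathcal{H})\to\mathcal{L}(\mathcal{H})$. An ex-ante-ex-post control protocol is a family $\{(\mathcal{I}_\omega,\mathcal{C}_\omega)\}_{\omega\in\Omega}$ indexed by a finite set $\Omega$ (arbitrary, depending on the protocol), where each $\mathcal{I}_\omega:\mathcal{L}(\mathcal{H})\to\mathcal{L}(\mathcal{H})$ is completely positive, $\sum_{\omega\in\Omega}\mathcal{I}_\omega$ is trace-preserving (i.e. $\{\mathcal{I}_\omega\}$ is a CP instrument), and each $\mathcal{C}_\omega:\mathcal{L}(\mathcal{H})\to\mathcal{L}(\mathcal{H})$ is TPCP. The average operation of the protocol for noise $\mathcal{N}$ is $\mathcal{E}=\sum_{\omega\in\Omega}\mathcal{C}_\omega\circ\mathcal{N}\circ\mathcal{I}_\omega$, and its average fidelity is $$\bar F=\int_{\|\psi\|=1}\langle\psi|\,\mathcal{E}(|\psi\rangle\langle\psi|)\,|\psi\rangle\,d\psi ,$$ where $d\psi$ is the normalized uniform (unitarily invariant) probability measure on the unit sphere of $\mathcal{H}$. A protocol is optimal for $\mathcal{N}$ (optimally suppresses $\mathcal{N}$) if its average fidelity for $\mathcal{N}$ is greater than or equal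 to that of every ex-ante-ex-post control protocol; the optimal average fidelity is this maximal value. Geometry of unital noise ($\dim\mathcal{H}=2$). Let $\sigma_0=1$ be the identity and $\sigma_1,\sigma_2,\sigma_3$ the Pauli operators. $T$ is the set of maps $\mathcal{N}(\rho)=\sum_{\mu=0}^3\alpha^\mu\sigma_\mu\rho\sigma_\mu$ with $\alpha^\mu\ge0$ and $\sum_\mu\alpha^\mu=1$. Each such map satisfies $\mathcal{N}(1)=1$ and $\mathcal{N}(\sigma_i)=d^i\sigma_i$ (no sum) with $(d^1,d^2,d^3)=\alpha^0(1,1,1)+\alpha^1(1,-1,-1)+\alpha^2(-1,1,-1)+\alpha^3(-1,-1,1)$, and the map is identified with the point $(d^1,d^2,d^3)\in\mathbb{R}^3$; thus $T$ is identified with the (solid) tetrahedron with vertices $\mathcal{E}_0=(1,1,1)$, $\mathcal{E}_1=(1,-1,-1)$, $\mathcal{E}_2=(-1,1,-1)$, $\mathcal{E}_3=(-1,-1,1)$. For $\mu\ne\nu$ let $\mathcal{E}_{\mu\nu}$ be the midpoint of $\mathcal{E}_\mu$ and $\mathcal{E}_\nu$. $O$ is the (solid) octahedron that is the convex hull of the six midpoints $\mathcal{E}_{\mu\nu}$, i.e. of $(\pm1,0,0),(0,\pm1,0),(0,0,\pm1)$. For $\mu=0,1,2,3$, $T_\mu$ is the (solid, closed) tetrahedron that is the convex hull of $\mathcal{E}_\mu$ and the three midpoints $\mathcal{E}_{\mu\nu}$, $\nu\neq\mu$; these are the four tetrahedra forming the closure of $T\setminus O$, so $T=O\cup T_0\cup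 T_1\cup T_2\cup T_3$. *)

(* Defs.v *)
From HB Require Import structures.
From mathcomp Require Import all_boot all_order all_algebra.
From mathcomp Require Import all_classical all_reals all_analysis.
From mathcomp Require Export complex.

Set Implicit Arguments.
Unset Strict Implicit.
Unset Printing Implicit Defensive.

Import Order.TTheory GRing.Theory Num.Theory.

Local Open Scope classical_set_scope.
Local Open Scope complex_scope.
Local Open Scope sesquilinear_scope.
Local Open Scope ring_scope.

(* H = C^n with its standard inner product, and L(H) = 'M[R[i]]_n *)
Definition ket (R : realType) (n : nat) := 'cV[R[i]]_n.

HB.instance Definition _ (R : realType) (n : nat) := Choice.on (ket R n).
HB.instance Definition _ (R : realType) (n : nat) :=
  isPointed.Build (ket R n) (0 : 'cV[R[i]]_n).

Definition superop (R : realType) (n : nat) := 'M[R[i]]_n -> 'M[R[i]]_n.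

Definition bracket (R : realType) (n : nat) (u v : 'cV[R[i]]_n) : R[i] :=
  (u^t* *m v) 0 0.

Definition ketbra (R : realType) (n : nat) (u v : 'cV[R[i]]_n) : 'M[R[i]]_n :=
  u *m v^t*.

Definition orthonormal_basis (R : realType) (n : nat)
    (phi : 'I_n -> 'cV[R[i]]_n) : Prop :=
  forall i j, bracket (phi i) (phi j) = (i == j)%:R.

(* In R[i], 0 <= z means that z is real and nonnegative. *)
Definition psd (R : realType) (n : nat) (A : 'M[R[i]]_n) : Prop :=
  forall v : 'cV[R[i]]_n, 0 <= bracket v (A *m v).

(* id (x) E on L(C^k (x) H), an operator on C^k (x) H being a k x k block
   matrix with blocks in L(H) *)
Definition ampliation (R : realType) (n k : nat) (E : superop R n)
    (X : 'M[R[i]]_(\sum_(i < k) n)) : 'M[R[i]]_(\sum_(i < k) n) :=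
  \mxblock_(i < k, j < k) E (submxblock X i j).

Definition completely_positive (R : realType) (n : nat) (E : superop R n) : Prop :=
  linear E /\
  forall (k : nat) (X : 'M[R[i]]_(\sum_(i < k) n)),
    psd X -> psd (ampliation E X).

Definition trace_preserving (R : realType) (n : nat) (E : superop R n) : Prop :=
  forall rho, \tr (E rho) = \tr rho.

Definition tpcp (R : realType) (n : nat) (E : superop R n) : Prop :=
  trace_preserving E /\ completely_positive E.

Definition unital (R : realType) (n : nat) (E : superop R n) : Prop :=
  E 1%:M = 1%:M.

(* The real and imaginary parts of the coordinates generate the Borel
   sigma-algebra of C^n = R^(2n). *)
Definition coord_cylinders (R : realType) (n : nat) : set (set (ket R n)) :=
  [set A | exists (i : 'I_n) (B : set R), measurable B /\
     (A = [set psi | B (complex.Re ((psi : 'cV[R[i]]_n) i 0))] \/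
      A = [set psi | B (complex.Im ((psi : 'cV[R[i]]_n) i 0))])].

Definition borel_ket (R : realType) (n : nat) :=
  g_sigma_algebraType (@coord_cylinders R n).

Definition unit_sphere (R : realType) (n : nat) : set (borel_ket R n) :=
  [set psi | bracket psi psi = 1].

Definition uniform_on_sphere (R : realType) (n : nat)
    (mu : probability (borel_ket R n) R) : Prop :=
  mu (@unit_sphere R n) = 1%E /\
  forall U : 'M[R[i]]_n, U \is unitarymx ->
  forall A : set (borel_ket R n), measurable A ->
    mu [set psi | A (U *m psi)] = mu A.

Record control (R : realType) (n : nat) := Control {
  outcomes : finType;
  ex_ante : outcomes -> superop R n;
  ex_post : outcomes -> superop R n }.

Definition is_protocol (R : realType) (n : nat) (P : control R n) : Prop :=
  [/\ forall w, completely_positive (@ex_ante R n P w),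
      trace_preserving (fun rho => \sum_w @ex_ante R n P w rho)
    & forall w, tpcp (@ex_post R n P w)].

Definition average_operation (R : realType) (n : nat) (N : superop R n)
    (P : control R n) : superop R n :=
  fun rho => \sum_w @ex_post R n P w (N (@ex_ante R n P w rho)).

(* The bracket below is real whenever the average operation is positive;
   complex.Re only moves it from R[i] to R. *)
Definition average_fidelity (R : realType) (n : nat)
    (mu : probability (borel_ket R n) R) (N : superop R n)
    (P : control R n) : R :=
  \int[mu]_(psi in @unit_sphere R n)
    complex.Re (bracket psi (average_operation N P (ketbra psi psi) *m psi)).

Definition optimal (R : realType) (n : nat)
    (mu : probability (borel_ket R n) R) (N : superop R n)
    (P : control R n) : Prop :=
  is_protocol P /\
  forall Q : control R n, is_protocol Q ->
    average_fidelity mu N Q <= average_fidelity mu N P.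

Definition optimal_average_fidelity (R : realType) (n : nat)
    (mu : probability (borel_ket R n) R) (N : superop R n) (F : R) : Prop :=
  (exists2 P : control R n, is_protocol P & average_fidelity mu N P = F) /\
  forall Q : control R n, is_protocol Q -> average_fidelity mu N Q <= F.

Definition no_measurement (R : realType) (n : nat) (S : 'M[R[i]]_n) :
    control R n :=
  @Control R n unit (fun _ rho => rho) (fun _ rho => S *m rho *m S).

Definition discriminate_reprepare (R : realType) (n : nat)
    (phi : 'I_n -> 'cV[R[i]]_n) : control R n :=
  @Control R n 'I_n
    (fun w rho => ketbra (phi w) (phi w) *m rho *m ketbra (phi w) (phi w))
    (fun w rho => \tr rho *: ketbra (phi w) (phi w)).

Definition mx2 (R : realType) (a b c d : R[i]) : 'M[R[i]]_2 :=
  \matrix_(i < 2, j < 2)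
    nth 0 (nth [::] [:: [:: a; b]; [:: c; d]] i) j.

Definition pauli (R : realType) (m : 'I_4) : 'M[R[i]]_2 :=
  nth 0 [:: 1%:M;
            mx2 0 1 1 0;
            mx2 0 (- 'i%C) 'i%C 0;
            mx2 1 0 0 (-1)] m.

(* N(sigma_i) = d^i sigma_i for i = 1, 2, 3; the index i : 'I_3 is shifted,
   lift ord0 i : 'I_4 having value i + 1. *)
Definition pauli_diagonal (R : realType) (N : superop R 2) (d : 'rV[R]_3) : Prop :=
  forall i : 'I_3,
    N (pauli R (lift ord0 i)) = (d 0 i)%:C *: pauli R (lift ord0 i).

Definition conv_hull (R : realType) (k : nat) (S : set 'rV[R]_k) :
    set 'rV[R]_k :=
  [set p | exists (m : nat) (v : 'I_m -> 'rV[R]_k) (a : 'I_m -> R),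
     [/\ forall i, S (v i), forall i, 0 <= a i, \sum_i a i = 1
       & p = \sum_i a i *: v i]].

Definition vertex (R : realType) (m : 'I_4) : 'rV[R]_3 :=
  \row_(j < 3)
    nth 0 (nth [::] [:: [:: 1; 1; 1];
                        [:: 1; -1; -1];
                        [:: -1; 1; -1];
                        [:: -1; -1; 1]] m) j.

Definition midpoint (R : realType) (m m' : 'I_4) : 'rV[R]_3 :=
  2^-1 *: (vertex R m + vertex R m').

Definition tetrahedron (R : realType) : set 'rV[R]_3 :=
  conv_hull (range (vertex R)).

Definition octahedron (R : realType) : set 'rV[R]_3 :=
  conv_hull [set p | exists m m' : 'I_4, m != m' /\ p = midpoint R m m'].

Definition corner (R : realType) (m : 'I_4) : set 'rV[R]_3 :=
  conv_hull (vertex R m |`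
    [set p | exists m' : 'I_4, m' != m /\ p = midpoint R m m']).

(* Main.v *)
(* Writing r_m for the expectation of the Pauli operator sigma_m in the state
   psi, invariance under the Pauli operators and under one rotation permuting
   the axes gives E[r_i] = 0 and E[r_i r_j] = delta_ij / 3, so an average
   operation E has fidelity 1/2 + score(E) / 12, where
   score(E) = sum_i tr(sigma_i E(sigma_i)).  The score is affine in the noise N,
   so it suffices to bound it at the vertices of the solid containing N.  At a
   vertex of the tetrahedron N is unitary, and positivity of the controlled
   channel yields score <= 6.  At a vertex of the octahedron N measures and
   reprepares: with P_s the eigenprojections and tau_s the states obtained after
   the control, the contribution of an outcome is sum_s tr(P_s I(2 tau_s - 1)),
   at most tr I(1) because tau_s <= 1, whence score <= 2.  Both bounds use only
   the positivity of the controls, and they are attained. *)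
From HB Require Import structures.
Require Import Defs.
From mathcomp Require Import all_boot all_order all_algebra.
From mathcomp Require Import all_classical all_reals all_analysis.
From mathcomp Require Import measurable_realfun ring lra.
Import Order.TTheory GRing.Theory Num.Theory.
Local Open Scope ring_scope.

Set Implicit Arguments.
Unset Strict Implicit.
Unset Printing Implicit Defensive.

(** * Superoperators given with a proof of linearity *)

Section Linear.
Variables (R : realType) (n : nat) (E : superop R n).
Hypothesis linE : linear E.

(** Bundling [E] with its linearity proof makes the generic theory of linear maps apply to a bare
    function. *)
Let L : {linear 'M[R[i]]_n -> 'M[R[i]]_n} :=
  HB.pack E (GRing.isLinear.Build R[i] 'M[R[i]]_n 'M[R[i]]_n *:%R E linE).

Lemma superopD X Y : E (X + Y) = E X + E Y.
Proof. exact: (linearD L). Qed.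

Lemma superopB X Y : E (X - Y) = E X - E Y.
Proof. exact: (linearB L). Qed.

Lemma superopZ a X : E (a *: X) = a *: E X.
Proof. exact: (linearZ_LR L). Qed.

Lemma superop_sum (J : Type) (r : seq J) (P : pred J) (F : J -> 'M[R[i]]_n) :
  E (\sum_(j <- r | P j) F j) = \sum_(j <- r | P j) E (F j).
Proof. exact: (linear_sum L). Qed.

End Linear.

(** * Algebra of the conjugate transpose *)

Section Adjoint.
Local Open Scope sesquilinear_scope.
Variable C : numClosedFieldType.

Lemma adjmx_mul m n p (A : 'M[C]_(m, n)) (B : 'M[C]_(n, p)) :
  (A *m B) ^t* = B ^t* *m A ^t*.
Proof. by rewrite trmx_mul map_mxM. Qed.

Lemma adjmxK m n (A : 'M[C]_(m, n)) : (A ^t*) ^t* = A.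
Proof. by apply/matrixP => i j; rewrite !mxE conjCK. Qed.

Lemma adjmxD m n (A B : 'M[C]_(m, n)) : (A + B) ^t* = A ^t* + B ^t*.
Proof. by rewrite linearD map_mxD. Qed.

Lemma adjmxZ m n a (A : 'M[C]_(m, n)) : (a *: A) ^t* = a^* *: A ^t*.
Proof. by rewrite linearZ /= map_mxZ. Qed.

Lemma adjmx1 n : (1%:M : 'M[C]_n) ^t* = 1%:M.
Proof. by rewrite trmx1 map_mx1. Qed.

End Adjoint.

(** * Positive semidefinite matrices and completely positive maps *)

Section Positivity.
Local Open Scope sesquilinear_scope.
Variable R : realType.

Lemma psd_congr n m (K : 'M[R[i]]_(m, n)) (A : 'M[R[i]]_n) :
  psd A -> psd (K *m A *m K ^t*).
Proof.
move=> Apsd v; have := Apsd (K ^t* *m v).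
by rewrite /bracket adjmx_mul adjmxK !mulmxA.
Qed.

Lemma psd1 n : psd (1%:M : 'M[R[i]]_n).
Proof.
move=> v; rewrite mul1mx /bracket mxE sumr_ge0 // => i _.
by rewrite !mxE mulrC mul_conjC_ge0.
Qed.

Lemma psd_gram n m (K : 'M[R[i]]_(m, n)) : psd (K *m K ^t*).
Proof. by have := psd_congr K (@psd1 n); rewrite mulmx1. Qed.

Lemma psdD n (A B : 'M[R[i]]_n) : psd A -> psd B -> psd (A + B).
Proof.
by move=> pA pB v; rewrite mulmxDl /bracket mulmxDr mxE addr_ge0 ?pA ?pB.
Qed.

Lemma psd0 n : psd (0 : 'M[R[i]]_n).
Proof. by move=> v; rewrite mul0mx /bracket mulmx0 mxE. Qed.

Lemma psd_sum n (J : finType) (F : J -> 'M[R[i]]_n) :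
  (forall j, psd (F j)) -> psd (\sum_j F j).
Proof.
move=> pF; elim/big_rec: _ => [|j A _ pA]; first exact: psd0.
exact: psdD (pF j) pA.
Qed.

(** Each diagonal entry is the expectation of [A] on a standard basis vector. *)
Lemma psd_trace_ge0 n (A : 'M[R[i]]_n) : psd A -> 0 <= \tr A.
Proof.
move=> pA; apply: sumr_ge0 => i _; have := pA (col i 1%:M).
rewrite /bracket tr_col trmx1 map_row map_mx1 rowE mulmx1 -rowE.
by rewrite colE mul1mx -colE !mxE.
Qed.

Definition positive n (E : superop R n) := forall X, psd X -> psd (E X).

Lemma ampliation_sum n k (J : finType) (E : J -> superop R n) X :
  ampliation (fun rho => \sum_j E j rho) X =
    \sum_j @ampliation R n k (E j) X.
Proof. by rewrite /ampliation mxblock_sum. Qed.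

Lemma cp_sum n (J : finType) (E : J -> superop R n) :
  (forall j, completely_positive (E j)) ->
  completely_positive (fun rho => \sum_j E j rho).
Proof.
move=> cpE; split=> [a X Y | k X pX].
  rewrite scaler_sumr -big_split; apply: eq_bigr => j _ /=.
  by have [->] := cpE j.
by rewrite ampliation_sum; apply: psd_sum => j; case: (cpE j) => _ /(_ _ _ pX).
Qed.

(** The ampliation of conjugation by [K] is conjugation by the block-diagonal matrix with [k] copies
    of [K], and conjugation preserves positivity. *)
Lemma cp_kraus n (K : 'M[R[i]]_n) :
  completely_positive (fun rho => K *m rho *m K ^t*).
Proof.
split=> [a X Y | k X pX].
  by rewrite mulmxDr mulmxDl -scalemxAr -scalemxAl.
suff -> : ampliation (fun rho => K *m rho *m K ^t*) X =
    (\mxdiag_(i < k) K) *m X *m (\mxdiag_(i < k) K) ^t*.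
  exact: psd_congr.
rewrite -{2}(submxblockK X) tr_mxdiag.
have -> : (\mxdiag_(i < k) K^T) ^ Num.conj = \mxdiag_(i < k) (K ^t*).
  apply/matrixP => a b; rewrite !mxE.
  by case: eqP => _; rewrite ?conform_mx_id !mxE ?rmorph0.
by rewrite mul_mxdiag_mxblock mul_mxblock_mxdiag.
Qed.

Lemma cp_ext n (E E' : superop R n) :
  E =1 E' -> completely_positive E -> completely_positive E'.
Proof. by move=> /funext ->. Qed.

(** This is complete positivity at [k = 1], up to identifying a matrix with a one-block matrix. *)
Lemma cp_positive n (E : superop R n) : completely_positive E -> positive E.
Proof.
case=> _ cpE X pX.
(* The dimensions [n] and [\sum_(i < 1) n] are equal but make distinct types; [J] is the unitary
   identification between them. *)
pose J : 'M[R[i]]_(n, \sum_(i < 1) n) := \mxrow_(i < 1) 1%:M.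
have JcE : J ^t* = \mxcol_(i < 1) 1%:M.
  by rewrite tr_mxrow; apply/matrixP => a b; rewrite !mxE rmorph_nat eq_sym.
have Jsub (Y : 'M[R[i]]_(\sum_(i < 1) n)) :
    J *m Y *m J ^t* = submxblock Y 0 0.
  rewrite -{1}(submxblockK Y) JcE mul_mxrow_mxblock mul_mxrow_mxcol.
  by rewrite big_ord1 mulmx1 big_ord1 mul1mx.
have Jblk (Y : 'M[R[i]]_n) :
    J ^t* *m Y *m J = \mxblock_(i < 1, j < 1) Y.
  rewrite JcE mxcol_mul mul_mxcol_mxrow.
  by apply/eq_mxblockP => i j; rewrite mul1mx mulmx1.
have := psd_congr J (cpE 1%N _ (psd_congr (J ^t*) pX)).
by rewrite adjmxK Jsub Jblk /ampliation !mxblockK.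
Qed.

End Positivity.

(** * Entrywise computation with 2 x 2 matrices *)

Section Mx2.
Local Open Scope sesquilinear_scope.
Variable R : realType.
Implicit Types a b c d : R[i].

Lemma mx2_eta (A : 'M[R[i]]_2) : A = mx2 (A 0 0) (A 0 1) (A 1 0) (A 1 1).
Proof.
apply/matrixP => i j; rewrite mxE.
case: i j => [[|[|//]] ?] [[|[|//]] ?] /=; congr (A _ _); exact/val_inj.
Qed.

Lemma mx2D a b c d a' b' c' d' :
  mx2 a b c d + mx2 a' b' c' d' = mx2 (a + a') (b + b') (c + c') (d + d').
Proof.
by apply/matrixP => i j; rewrite !mxE; case: i j => [[|[|//]] ?] [[|[|//]] ?].
Qed.

Lemma mx2Z k a b c d :
  k *: mx2 a b c d = mx2 (k * a) (k * b) (k * c) (k * d).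
Proof.
by apply/matrixP => i j; rewrite !mxE; case: i j => [[|[|//]] ?] [[|[|//]] ?].
Qed.

Lemma mx2M a b c d a' b' c' d' :
  mx2 a b c d *m mx2 a' b' c' d' =
  mx2 (a * a' + b * c') (a * b' + b * d') (c * a' + d * c') (c * b' + d * d').
Proof.
apply/matrixP => i j; rewrite !mxE !big_ord_recl big_ord0 addr0 !mxE.
by case: i j => [[|[|//]] ?] [[|[|//]] ?].
Qed.

Lemma mx2_1 : 1%:M = mx2 1 0 0 1 :> 'M[R[i]]_2.
Proof.
by apply/matrixP => i j; rewrite !mxE; case: i j => [[|[|//]] ?] [[|[|//]] ?].
Qed.

Lemma tr_mx2 a b c d : \tr (mx2 a b c d) = a + d.
Proof. by rewrite /mxtrace !big_ord_recl big_ord0 addr0 !mxE. Qed.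

Lemma adj_mx2 a b c d : (mx2 a b c d) ^t* = mx2 a^* c^* b^* d^*.
Proof.
by apply/matrixP => i j; rewrite !mxE; case: i j => [[|[|//]] ?] [[|[|//]] ?].
Qed.

Definition mx2E := (mx2D, mx2Z, mx2M, tr_mx2, adj_mx2).

Lemma mulii : 'i%C * 'i%C = -1 :> R[i].
Proof. by rewrite -expr2 sqr_i. Qed.

Lemma conj_i : ('i%C : R[i])^* = - 'i%C.
Proof. by apply/eqP; rewrite eq_complex /= oppr0 !eqxx. Qed.

End Mx2.

(** * Pauli operators and the midpoints of the tetrahedron *)

Section Pauli.
Local Open Scope sesquilinear_scope.
Local Open Scope complex_scope.
Variable R : realType.
Local Notation S m := (pauli R m).

Lemma pauli0 : S ord0 = 1%:M. Proof. by []. Qed.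

Lemma pauli_herm m : (S m) ^t* = S m.
Proof.
case: m => [[|[|[|[|//]]]] ?]; rewrite /pauli /= ?adjmx1 // adj_mx2;
  by rewrite ?rmorphN /= ?conj_i ?rmorph0 ?rmorph1 ?opprK.
Qed.

Lemma pauli_sqr m : S m *m S m = 1%:M.
Proof.
case: m => [[|[|[|[|//]]]] ?]; rewrite /pauli /= ?mulmx1 // mx2M mx2_1.
- by congr mx2; ring.
- by congr mx2; ring: (mulii R).
- by congr mx2; ring.
Qed.

(** The four Pauli operators form an orthogonal basis for the trace inner product, each of squared
    norm 2. *)
Lemma pauli_expansion (A : 'M[R[i]]_2) :
  A = 2^-1 *: \sum_m \tr (S m *m A) *: S m.
Proof.
rewrite !big_ord_recl big_ord0 addr0 /pauli /= [A]mx2_eta mx2_1 !mx2E.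
congr mx2.
- by field.
- by field: (mulii R).
- by field: (mulii R).
- by field.
Qed.

Lemma tr_pauli (i : 'I_3) : \tr (S (lift ord0 i)) = 0.
Proof.
by case: i => [[|[|[|//]]] ?]; rewrite /pauli /= tr_mx2 ?addr0 ?subrr.
Qed.

(** Two Pauli operators commute or anticommute, and the resulting signs are the coordinates of the
    vertices: each vertex is a unitary Pauli channel. *)
Lemma pauli_conj m (i : 'I_3) :
  S m *m S (lift ord0 i) *m S m =
  ((vertex R m) 0 i)%:C *: S (lift ord0 i).
Proof.
case: m i => [[|[|[|[|//]]]] ?] [[|[|[|//]]] ?];
  rewrite mxE /pauli /= ?mul1mx ?mulmx1 ?scale1r // ?rmorphN ?rmorph1 !mx2E;
  congr mx2; ring: (mulii R).
Qed.

Lemma midpoint_axis (m m' : 'I_4) : m != m' ->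
  exists (j : 'I_3) (e : bool), midpoint R m m' = (-1) ^+ e *: delta_mx 0 j.
Proof.
rewrite -val_eqE /midpoint.
have K (j : 'I_3) (e : bool) (u v : 'rV[R]_3) : (forall k : 'I_3, 2^-1 * (u 0 k + v 0 k) =
    (-1) ^+ e * (k == j)%:R) ->
  exists (j' : 'I_3) (e' : bool),
    2^-1 *: (u + v) = (-1) ^+ e' *: delta_mx 0 j'.
  by move=> h; exists j, e; apply/rowP => k; rewrite !mxE h.
case: m m' => [[|[|[|[|//]]]] ?] [[|[|[|[|//]]]] ?] //= _;
(* The twelve ordered pairs of distinct vertices fall on six half-axes; the alternative whose
   coordinates check is kept. *)
first [ apply: (K 0 false); case=> [[|[|[|//]]] ?]; rewrite !mxE /=; by field
 | apply: (K 0 true); case=> [[|[|[|//]]] ?]; rewrite !mxE /=; by field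
 | apply: (K 1 false); case=> [[|[|[|//]]] ?]; rewrite !mxE /=; by field
 | apply: (K 1 true); case=> [[|[|[|//]]] ?]; rewrite !mxE /=; by field
 | apply: (K 2 false); case=> [[|[|[|//]]] ?]; rewrite !mxE /=; by field
 | apply: (K 2 true); case=> [[|[|[|//]]] ?]; rewrite !mxE /=; by field ].
Qed.

End Pauli.

(** * Pauli-diagonal channels and the spectral projections of the Pauli operators *)

Section PauliChannel.
Local Open Scope sesquilinear_scope.
Variable R : realType.
Local Open Scope complex_scope.
Local Open Scope ring_scope.
Local Notation S m := (pauli R m).
Local Notation sigma i := (pauli R (lift ord0 i)).

(** No constraint is put on [d], so that the channel can be evaluated at any point of a convex
    decomposition. *)
Definition pauli_map (d : 'rV[R]_3) : superop R 2 := fun X =>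
  2^-1 *: (\tr X *: 1%:M +
           \sum_(i < 3) ((d 0 i)%:C * \tr (sigma i *m X)) *: sigma i).

Lemma pauli_mapE (E : superop R 2) d :
  linear E -> unital E -> pauli_diagonal E d -> E =1 pauli_map d.
Proof.
move=> linE E1 Ed X; rewrite {1}(pauli_expansion X) superopZ // superop_sum //.
rewrite big_ord_recl superopZ // pauli0 E1 mul1mx; congr (_ *: (_ + _)).
by apply: eq_bigr => i _; rewrite superopZ // Ed scalerA mulrC.
Qed.

Lemma pauli_map_vertex m X : S m *m X *m S m = pauli_map (vertex R m) X.
Proof.
apply: (@pauli_mapE (fun X => S m *m X *m S m)) => [a Y Z| | i].
- by rewrite mulmxDr mulmxDl -scalemxAr -scalemxAl.
- by rewrite /unital mulmx1 pauli_sqr.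
- exact: pauli_conj.
Qed.

(** The identity component does not involve [d], so the dependence is affine rather than linear and
    the weights must sum to 1. *)
Lemma pauli_map_conv k (v : 'I_k -> 'rV[R]_3) (a : 'I_k -> R) X :
  \sum_j a j = 1 ->
  pauli_map (\sum_j a j *: v j) X = \sum_j (a j)%:C *: pauli_map (v j) X.
Proof.
move=> a1; rewrite /pauli_map.
under [RHS]eq_bigr do rewrite scalerA mulrC -scalerA scalerDr.
rewrite -scaler_sumr big_split /= -scaler_suml -rmorph_sum a1 scale1r.
congr (_ *: (_ + _)).
under [RHS]eq_bigr do rewrite scaler_sumr.
rewrite exchange_big; apply: eq_bigr => i _ /=.
under [RHS]eq_bigr do rewrite scalerA mulrA.
rewrite -scaler_suml -mulr_suml summxE; congr ((_ * _) *: _).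
by rewrite rmorph_sum; apply: eq_bigr => j _; rewrite mxE rmorphM.
Qed.

Definition eigenproj (j : 'I_3) (s : bool) : 'M[R[i]]_2 :=
  2^-1 *: (1%:M + (-1) ^+ s *: sigma j).

Let addmxx (A : 'M[R[i]]_2) : A + A = 2 *: A.
Proof. by rewrite scaler_nat mulr2n. Qed.

(** The matrix is Hermitian and idempotent because [sigma j] is Hermitian with square 1. The Gram
    form yields positivity at once. *)
Lemma eigenproj_gram j s :
  eigenproj j s = eigenproj j s *m (eigenproj j s) ^t*.
Proof.
rewrite /eigenproj adjmxZ adjmxD adjmx1 adjmxZ pauli_herm.
have -> : (2^-1 : R[i])^* = 2^-1 by rewrite fmorphV rmorph_nat.
rewrite rmorph_sign -scalemxAr -scalemxAl scalerA mulmxDl mul1mx.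
rewrite mulmxDr mulmx1 -scalemxAr -scalemxAl pauli_sqr scalerA.
rewrite -signr_addb addbb scale1r [_ + 1%:M]addrC addmxx scalerA.
congr (_ *: _); by field.
Qed.

Lemma psd_eigenproj j s : psd (eigenproj j s).
Proof. by rewrite eigenproj_gram; exact: psd_gram. Qed.

Lemma tr_eigenproj j s : \tr (eigenproj j s) = 1.
Proof.
by rewrite mxtraceZ mxtraceD mxtrace1 mxtraceZ tr_pauli mulr0 addr0 mulVf ?pnatr_eq0.
Qed.

(** By cyclicity the trace is that of [A] conjugated by the projection. *)
Lemma eigenproj_trace_ge0 j s A : psd A -> 0 <= \tr (eigenproj j s *m A).
Proof.
move=> pA; rewrite eigenproj_gram -mulmxA mxtrace_mulC.
rewrite -{2}[eigenproj j s]adjmxK.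
exact/psd_trace_ge0/psd_congr.
Qed.

Lemma tr_eigenproj_mul j s X : \tr (eigenproj j s *m X) =
  2^-1 * (\tr X + (-1) ^+ s * \tr (sigma j *m X)).
Proof.
rewrite /eigenproj -scalemxAl mxtraceZ mulmxDl mul1mx mxtraceD -scalemxAl.
by rewrite mxtraceZ.
Qed.

Lemma eigenproj1 j : eigenproj j false + eigenproj j true = 1%:M.
Proof.
rewrite -scalerDr addrACA -scalerDl expr0 expr1 subrr scale0r addr0.
by rewrite addmxx scalerA mulVf ?pnatr_eq0 // scale1r.
Qed.

Lemma eigenprojB j : eigenproj j false - eigenproj j true = sigma j.
Proof.
rewrite -scalerBr expr0 expr1 scale1r scaleN1r opprD opprK addrACA subrr add0r.
by rewrite addmxx scalerA mulVf ?pnatr_eq0 // scale1r.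
Qed.

(* At a vertex of the octahedron the channel measures sigma_j and reprepares
   an eigenstate, the opposite one when the sign (-1) ^+ e is negative. *)
Lemma pauli_map_axis j (e : bool) X :
  pauli_map ((-1) ^+ e *: delta_mx 0 j) X =
  \sum_s \tr (eigenproj j s *m X) *: eigenproj j (s (+) e).
Proof.
have dE i : ((-1) ^+ e *: delta_mx 0 j : 'rV[R]_3) 0 i = (-1) ^+ e * (i == j)%:R.
  by rewrite !mxE.
under eq_bigr do rewrite tr_eigenproj_mul.
rewrite big_bool /pauli_map (bigD1 j) //= big1 ?addr0 => [|i nij]; last first.
  by rewrite dE (negPf nij) mulr0 rmorph0 mul0r scale0r.
have {dE} -> : ((-1) ^+ e *: delta_mx 0 j : 'rV[R]_3) 0 j = (-1) ^+ e.
  by rewrite dE eqxx mulr1.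
move: (\tr X) (\tr (sigma j *m X)) => t u; rewrite /eigenproj.
rewrite !scalerA !scalerDr !scalerA [RHS]addrACA.
rewrite -[X in _ = X + _]scalerDl -[X in _ = _ + X]scalerDl.
rewrite rmorph_sign; case: e; rewrite /= !(expr0, expr1).
  by congr (_ *: _ + _ *: _); field.
by congr (_ *: _ + _ *: _); field.
Qed.

Lemma bracket_mx2 (v : 'cV[R[i]]_2) a b c d :
  bracket v (mx2 a b c d *m v) =
  (v 0 0)^* * (a * v 0 0 + b * v 1 0) + (v 1 0)^* * (c * v 0 0 + d * v 1 0).
Proof.
rewrite /bracket !mxE !big_ord_recl !big_ord0 !addr0 !mxE.
rewrite !big_ord_recl !big_ord0 !addr0 !mxE /=.
by rewrite (_ : lift ord0 ord0 = 1 :> 'I_2) //; exact/val_inj.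
Qed.

(* On the vector orthogonal to v, A has the expectation of tr A - A on v. *)
Lemma psd_trace_subr (A : 'M[R[i]]_2) : psd A -> psd (\tr A *: 1%:M - A).
Proof.
rewrite [A]mx2_eta; move: (A 0 0) (A 0 1) (A 1 0) (A 1 1) => a b c d pA v.
have -> : \tr (mx2 a b c d) *: 1%:M - mx2 a b c d = mx2 d (- b) (- c) a.
  by rewrite -scaleN1r mx2_1 !mx2E; congr mx2; ring.
have := pA (\col_i nth 0 [:: - (v 1 0)^*; (v 0 0)^*] i).
rewrite !bracket_mx2 !mxE /=.
rewrite rmorphN /= !conjCK; congr (0 <= _); ring.
Qed.

End PauliChannel.

(** * Upper bounds on the score *)

Lemma tr_mul_polar (R : realType) n (A B X Y : 'M[R[i]]_n) :
  \tr ((A + B) *m (X + Y)) - \tr ((A - B) *m (X - Y)) =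
  (\tr (A *m Y) + \tr (B *m X)) *+ 2.
Proof.
rewrite mulmxBl !mulmxBr mulmxDl !mulmxDr !raddfB !raddfD /=; ring.
Qed.

Lemma tr_mulZ (R : realType) n a (A B : 'M[R[i]]_n) :
  \tr (A *m (a *: B)) = a * \tr (A *m B).
Proof. by rewrite -scalemxAr mxtraceZ. Qed.

Lemma tr_mulBr (R : realType) n (A X Y : 'M[R[i]]_n) :
  \tr (A *m (X - Y)) = \tr (A *m X) - \tr (A *m Y).
Proof. by rewrite mulmxBr raddfB. Qed.

Section Score.
Variable R : realType.
Local Open Scope complex_scope.
Local Open Scope ring_scope.
Local Notation S m := (pauli R m).
Local Notation sigma i := (pauli R (lift ord0 i)).

Definition score (E : superop R 2) : R[i] := \sum_i \tr (sigma i *m E (sigma i)).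

(** With P and Q the two eigenprojections, 1 = P + Q and [sigma j] = P - Q, so by polarization the
    gap is twice tr(P E(Q)) + tr(Q E(P)), a sum of nonnegative terms. *)
Lemma tr_sigma_le (E : superop R 2) j :
  linear E -> positive E -> \tr (sigma j *m E (sigma j)) <= \tr (E 1%:M).
Proof.
move=> linE posE.
have := tr_mul_polar (eigenproj R j false) (eigenproj R j true)
  (E (eigenproj R j false)) (E (eigenproj R j true)).
rewrite -superopD // -superopB // eigenproj1 eigenprojB mul1mx => polar.
rewrite -subr_ge0 polar mulrn_wge0 // addr_ge0 //;
  exact/eigenproj_trace_ge0/posE/psd_eigenproj.
Qed.

Lemma score_le_3tr (E : superop R 2) :
  linear E -> positive E -> score E <= 3 * \tr (E 1%:M).
Proof.
move=> linE posE; rewrite mulr_natl.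
have -> : \tr (E 1%:M) *+ 3 = \sum_(i < 3) \tr (E 1%:M).
  by rewrite sumr_const card_ord.
by apply: ler_sum => i _; exact: tr_sigma_le.
Qed.

(** This is the Pauli expansion of [A], doubled, with its identity term moved to the other side. *)
Lemma sigma_expansion (A : 'M[R[i]]_2) :
  \sum_i \tr (sigma i *m A) *: sigma i = 2 *: A - \tr A *: 1%:M.
Proof.
rewrite [X in 2 *: X]pauli_expansion scalerA divff ?pnatr_eq0 // scale1r.
by rewrite [in RHS]big_ord_recl pauli0 mul1mx addrC addKr.
Qed.

Section PostPre.
Variables C I : superop R 2.
Hypotheses (tpcpC : tpcp C) (cpI : completely_positive I).

Let trC : trace_preserving C. Proof. by case: tpcpC. Qed.
Let linC : linear C. Proof. by case: tpcpC => _ []. Qed.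
Let posC : positive C. Proof. by case: tpcpC => _ /cp_positive. Qed.
Let linI : linear I. Proof. by case: cpI. Qed.
Let posI : positive I. Proof. exact: cp_positive. Qed.

(** Conjugation by a Pauli operator is positive and preserves the trace, so the whole composite is
    positive and sends 1 to an operator of trace [\tr (I 1%:M)]. *)
Lemma score_vertex m :
  score (fun X => C (pauli_map (vertex R m) (I X))) <= 3 * \tr (I 1%:M).
Proof.
have -> : \tr (I 1%:M) = \tr (C (pauli_map (vertex R m) (I 1%:M))).
  rewrite trC -pauli_map_vertex -mulmxA mxtrace_mulC -mulmxA.
  by rewrite pauli_sqr mulmx1.
apply: score_le_3tr => [a X Y | X pX].
  rewrite -!pauli_map_vertex linI mulmxDr mulmxDl -scalemxAr -scalemxAl.
  exact: linC.
rewrite -pauli_map_vertex -{2}(pauli_herm R m).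
by apply: posC; apply: psd_congr; exact: posI.
Qed.

Lemma score_midpoint m m' : m != m' ->
  score (fun X => C (pauli_map (midpoint R m m') (I X))) <= \tr (I 1%:M).
Proof.
move=> /(midpoint_axis R)[j [e ->]].
pose tau s := C (eigenproj R j (s (+) e)).
(* The sum over i of tr(P_s I(sigma_i)) tr(sigma_i tau_s) is rearranged by linearity of [I], which
   moves the second factor inside: the sigma_i then recombine into 2 tau_s - 1. *)
have -> : score (fun X => C (pauli_map ((-1) ^+ e *: delta_mx 0 j) (I X))) =
    \sum_s \tr (eigenproj R j s *m I (2 *: tau s - 1%:M)).
  rewrite /score; under eq_bigr do rewrite pauli_map_axis superop_sum //
    mulmx_sumr raddf_sum /=.
  rewrite exchange_big; apply: eq_bigr => s _ /=.
  have -> : 2 *: tau s - 1%:M = \sum_i \tr (sigma i *m tau s) *: sigma i.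
    by rewrite sigma_expansion trC tr_eigenproj scale1r.
  rewrite superop_sum // mulmx_sumr raddf_sum /=; apply: eq_bigr => i _.
  transitivity (\tr (eigenproj R j s *m I (sigma i)) * \tr (sigma i *m tau s)).
    by rewrite (superopZ linC) tr_mulZ.
  by rewrite (superopZ linI) tr_mulZ mulrC.
have -> : \tr (I 1%:M) = \sum_s \tr (eigenproj R j s *m I 1%:M).
  by rewrite big_bool /= addrC -mxtraceD -mulmxDl eigenproj1 mul1mx.
apply: ler_sum => s _; rewrite -subr_ge0 -tr_mulBr -(superopB linI).
apply: eigenproj_trace_ge0; apply: posI.
have -> : 1%:M - (2 *: tau s - 1%:M) =
    (1%:M - tau s) + (1%:M - tau s) :> 'M[R[i]]_2.
  by rewrite scaler_nat mulr2n opprB opprD addrA addrACA.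
(* A positive 2 x 2 matrix of trace 1 is at most the identity. *)
have ptau : psd (1%:M - tau s).
  have := psd_trace_subr (posC (psd_eigenproj j (s (+) e))).
  by rewrite trC tr_eigenproj scale1r.
exact: psdD.
Qed.

(** The score is affine in the noise, so bounds at the points [v j] average with the same
    weights. *)
Lemma score_conv_le k (v : 'I_k -> 'rV[R]_3) (a c : 'I_k -> R) :
  (forall j, 0 <= a j) -> \sum_j a j = 1 ->
  (forall j, score (fun X => C (pauli_map (v j) (I X)))
             <= (c j)%:C * \tr (I 1%:M)) ->
  score (fun X => C (pauli_map (\sum_j a j *: v j) (I X)))
    <= (\sum_j a j * c j)%:C * \tr (I 1%:M).
Proof.
move=> a0 a1 le_c.
have -> : score (fun X => C (pauli_map (\sum_j a j *: v j) (I X))) =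
    \sum_j (a j)%:C * score (fun X => C (pauli_map (v j) (I X))).
  rewrite /score; under [RHS]eq_bigr do rewrite mulr_sumr.
  rewrite [RHS]exchange_big; apply: eq_bigr => i _ /=.
  rewrite pauli_map_conv // superop_sum // mulmx_sumr raddf_sum /=.
  by apply: eq_bigr => j _; rewrite (superopZ linC) tr_mulZ.
rewrite rmorph_sum mulr_suml; apply: ler_sum => j _.
by rewrite rmorphM -mulrA ler_wpM2l // ler0c.
Qed.

End PostPre.
End Score.

(** * Geometry of the corner tetrahedra *)

Section Tetrahedron.
Variable R : realType.
Local Open Scope classical_set_scope.
Local Open Scope ring_scope.

Definition dot (u v : 'rV[R]_3) := \sum_i u 0 i * v 0 i.

(** The functional [dot (vertex R m)] takes the values 3 and 1 at the vertex and the midpoints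
    spanning corner [m], which are exactly the constants in the score bounds there; it therefore
    interpolates these bounds over the corner. *)
Lemma vertex_dot m : dot (vertex R m) (vertex R m) = 3.
Proof.
rewrite /dot !big_ord_recl big_ord0 !mxE.
by case: m => [[|[|[|[|//]]]] ?] /=; ring.
Qed.

Lemma vertex_dot_midpoint m m' :
  m' != m -> dot (vertex R m) (midpoint R m m') = 1.
Proof.
rewrite -val_eqE /dot !big_ord_recl big_ord0 !mxE.
by case: m m' => [[|[|[|[|//]]]] ?] [[|[|[|[|//]]]] ?] //= _; field.
Qed.

Lemma normr_vertex m i : `|vertex R m 0 i| = 1.
Proof.
by case: m i => [[|[|[|[|//]]]] ?] [[|[|[|//]]] ?];
  rewrite mxE /= ?normrN normr1.
Qed.

Lemma vertex_mul_midpoint_ge0 m m' i :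
  0 <= vertex R m 0 i * midpoint R m m' 0 i.
Proof.
by case: m m' i => [[|[|[|[|//]]]] ?] [[|[|[|[|//]]]] ?] [[|[|[|//]]] ?];
  rewrite !mxE /=; lra.
Qed.

Lemma dot_conv u k (v : 'I_k -> 'rV[R]_3) (a : 'I_k -> R) :
  dot u (\sum_j a j *: v j) = \sum_j a j * dot u (v j).
Proof.
rewrite /dot; under [RHS]eq_bigr do rewrite mulr_sumr.
rewrite exchange_big; apply: eq_bigr => i _ /=.
by rewrite summxE mulr_sumr; apply: eq_bigr => j _; rewrite mxE mulrCA.
Qed.

(** On corner [m] no coordinate of [d] has sign opposite to that of the vertex, whose coordinates
    are 1 or -1, so each product is an absolute value. *)
Lemma corner_dot m d : corner m d -> dot (vertex R m) d = \sum_i `|d 0 i|.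
Proof.
move=> [k [v [a [vS a0 a1 ->]]]]; apply: eq_bigr => i _.
rewrite -[RHS]mul1r -(normr_vertex m i) -normrM ger0_norm // summxE mulr_sumr.
apply: sumr_ge0 => j _; rewrite [X in _ * X]mxE mulrCA mulr_ge0 //.
case: (vS j) => [-> | [m' [_ ->]]]; last exact: vertex_mul_midpoint_ge0.
by rewrite -expr2 sqr_ge0.
Qed.

End Tetrahedron.

(** * Bloch coordinates of a vector and the fidelity as a quadratic form in them *)

Section Bloch.
Variable R : realType.
Local Open Scope sesquilinear_scope.
Local Open Scope complex_scope.
Local Open Scope classical_set_scope.
Local Open Scope ring_scope.
Local Notation S m := (pauli R m).
Local Notation sigma i := (pauli R (lift ord0 i)).

Definition bloch (m : 'I_4) (psi : borel_ket R 2) : R :=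
  complex.Re (bracket psi (S m *m psi)).

Lemma bracket_herm n (A : 'M[R[i]]_n) (u : 'cV[R[i]]_n) :
  A ^t* = A -> (complex.Re (bracket u (A *m u)))%:C = bracket u (A *m u).
Proof.
move=> hA; apply: RRe_real; rewrite CrealE; apply/eqP.
rewrite /bracket.
have -> : ((u ^t* *m (A *m u)) 0 0)^* = (u ^t* *m (A *m u)) ^t* 0 0.
  by rewrite !mxE.
by rewrite !adjmx_mul adjmxK hA mulmxA.
Qed.

Lemma Re_realM (a : R) (z : R[i]) :
  complex.Re (a%:C * z) = a * complex.Re z.
Proof. by case: z => x y /=; rewrite mul0r subr0. Qed.

Lemma bracket_trace n (A : 'M[R[i]]_n) (u : 'cV[R[i]]_n) :
  bracket u (A *m u) = \tr (A *m ketbra u u).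
Proof. by rewrite /bracket /ketbra mulmxA mxtrace_mulC /mxtrace big_ord1. Qed.

Lemma ketbra_bloch (psi : 'cV[R[i]]_2) :
  ketbra psi psi = 2^-1 *: \sum_m (bloch m psi)%:C *: S m.
Proof.
rewrite [LHS]pauli_expansion; congr (_ *: _); apply: eq_bigr => m _.
by rewrite -bracket_trace bracket_herm // pauli_herm.
Qed.

(** Both copies of the projector are expanded in Pauli operators, each with a factor 1/2. The
    dependence on [psi] is thereby confined to products of two Bloch coordinates. *)
Lemma fidelity_bloch (E : superop R 2) (psi : 'cV[R[i]]_2) : linear E ->
  complex.Re (bracket psi (E (ketbra psi psi) *m psi)) =
  \sum_m \sum_n 4^-1 * complex.Re (\tr (S m *m E (S n)))
                * (bloch m psi * bloch n psi).
Proof.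
move=> linE; rewrite bracket_trace mxtrace_mulC {1}ketbra_bloch.
rewrite -scalemxAl mxtraceZ mulmx_suml raddf_sum /=.
rewrite mulr_sumr raddf_sum /=; apply: eq_bigr => m _.
rewrite ketbra_bloch superopZ // superop_sum // -scalemxAl mxtraceZ.
rewrite -scalemxAr mulmx_sumr mxtraceZ raddf_sum /= !mulr_sumr raddf_sum /=.
apply: eq_bigr => n _; rewrite superopZ // -scalemxAr mxtraceZ.
have -> : 2^-1 * ((bloch m psi)%:C * (2^-1 * ((bloch n psi)%:C
      * \tr (S m *m E (S n))))) =
    (4^-1 * (bloch m psi * bloch n psi))%:C * \tr (S m *m E (S n)).
  by rewrite !rmorphM fmorphV rmorph_nat; field.
rewrite [LHS]Re_realM; ring.
Qed.

Local Notation x0 psi := (complex.Re ((psi : 'cV[R[i]]_2) 0 0)).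
Local Notation y0 psi := (complex.Im ((psi : 'cV[R[i]]_2) 0 0)).
Local Notation x1 psi := (complex.Re ((psi : 'cV[R[i]]_2) 1 0)).
Local Notation y1 psi := (complex.Im ((psi : 'cV[R[i]]_2) 1 0)).

(** The real polynomial form serves both measurability and the sphere identity. *)
Lemma blochE m (psi : borel_ket R 2) : bloch m psi =
  nth 0 [:: x0 psi * x0 psi + y0 psi * y0 psi + x1 psi * x1 psi + y1 psi * y1 psi;
            2 * (x0 psi * x1 psi + y0 psi * y1 psi);
            2 * (x0 psi * y1 psi - y0 psi * x1 psi);
            x0 psi * x0 psi + y0 psi * y0 psi - x1 psi * x1 psi - y1 psi * y1 psi] m.
Proof.
rewrite /bloch; case: m => [[|[|[|[|//]]]] ?] /=;
  rewrite /pauli /= ?mx2_1 bracket_mx2;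
  case: (_ 0 0) => a b; case: (_ 1 0) => c e /=; ring.
Qed.

Lemma bloch0 (psi : borel_ket R 2) : bloch ord0 psi = complex.Re (bracket psi psi).
Proof. by rewrite /bloch pauli0 mul1mx. Qed.

(** The difference of the two sides reflects the determinant of [ketbra psi psi], which vanishes
    because that matrix has rank at most one. *)
Lemma bloch_sqr_sum (psi : borel_ket R 2) :
  \sum_(i < 3) bloch (lift ord0 i) psi ^+ 2 = bloch ord0 psi ^+ 2.
Proof. rewrite !big_ord_recl big_ord0 !blochE /=; ring. Qed.

Lemma unit_sphere_bloch : @unit_sphere R 2 = [set psi : borel_ket R 2 | bloch ord0 psi = 1].
Proof.
apply/funext => psi; apply/propext; rewrite /unit_sphere /= bloch0.
have := @bracket_herm 2 1%:M psi (adjmx1 _ _); rewrite mul1mx => <-.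
by split=> [[]|->].
Qed.

Lemma bloch_le1 m psi : @unit_sphere R 2 psi -> `|bloch m psi| <= 1.
Proof.
rewrite unit_sphere_bloch /= => psi1.
case: (unliftP ord0 m) => [i ->|->]; last by rewrite psi1 normr1.
rewrite -(@ler_pXn2r _ 2) ?nnegrE // real_normK ?num_real // expr1n.
rewrite -[leRHS](expr1n _ 2) -psi1 -bloch_sqr_sum (bigD1 i) //= lerDl.
by apply: sumr_ge0 => j _; exact: sqr_ge0.
Qed.

(** Heisenberg picture: the unitary is moved from the vector to the observable. *)
Lemma bloch_unitary m n (U : 'M[R[i]]_2) psi (c : R) :
  U ^t* *m S m *m U = c%:C *: S n ->
  bloch m (U *m psi : 'cV__) = c * bloch n psi.
Proof.
move=> hU; rewrite /bloch /bracket adjmx_mul.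
have -> : psi ^t* *m U ^t* *m (S m *m (U *m psi)) =
   c%:C *: (psi ^t* *m (S n *m psi)).
  by rewrite -!mulmxA (mulmxA (S m)) (mulmxA (U ^t*)) (mulmxA (U ^t*)) hU -scalemxAl -scalemxAr.
by rewrite mxE Re_realM.
Qed.

End Bloch.

(** * Second moments of the Bloch coordinates under the uniform measure *)

Section Moments.
Variable R : realType.
Local Open Scope sesquilinear_scope.
Local Open Scope complex_scope.
Local Open Scope classical_set_scope.
Local Open Scope ring_scope.
Local Notation S m := (pauli R m).
Local Notation sigma i := (pauli R (lift ord0 i)).
Local Notation sphere := (@unit_sphere R 2).

Lemma measurable_coord_Re n (k : 'I_n) :
  measurable_fun setT (fun psi : borel_ket R n => complex.Re ((psi : 'cV[R[i]]_n) k 0)).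
Proof.
move=> _ B mB; rewrite setTI; apply: sub_sigma_algebra.
by exists k, B; split=> //; left.
Qed.

Lemma measurable_coord_Im n (k : 'I_n) :
  measurable_fun setT (fun psi : borel_ket R n => complex.Im ((psi : 'cV[R[i]]_n) k 0)).
Proof.
move=> _ B mB; rewrite setTI; apply: sub_sigma_algebra.
by exists k, B; split=> //; right.
Qed.

Definition rotate n (U : 'M[R[i]]_n) (psi : borel_ket R n) : borel_ket R n :=
  U *m psi.

(** It suffices to test the generating cylinders, and each real or imaginary part of [U *m psi] is a
    real linear combination of those of [psi]. *)
Lemma measurable_rotate n (U : 'M[R[i]]_n) : measurable_fun setT (rotate U).
Proof.
apply: (@measurability _ _ (borel_ket R n) (borel_ket R n) setT (rotate U)
  (@coord_cylinders R n) erefl).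
move=> _ [_ [k [B [mB [->|->]]]] <-].
- suff mf : measurable_fun setT (fun psi : borel_ket R n =>
      complex.Re ((rotate U psi : 'cV[R[i]]_n) k 0)) by exact: mf.
  under eq_fun do rewrite mxE raddf_sum /=.
  apply: measurable_sum => j.
  have -> : (fun psi : borel_ket R n => complex.Re (U k j * (psi : 'cV[R[i]]_n) j 0)) =
      (fun psi : borel_ket R n => complex.Re (U k j) * complex.Re ((psi : 'cV[R[i]]_n) j 0)
         - complex.Im (U k j) * complex.Im ((psi : 'cV[R[i]]_n) j 0)).
    by apply/funext => psi; case: (U k j) => a b; case: (_ j 0).
  by apply: measurable_funB; apply: measurable_funM => //;
    [exact: measurable_coord_Re | exact: measurable_coord_Im].
- suff mf : measurable_fun setT (fun psi : borel_ket R n =>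
      complex.Im ((rotate U psi : 'cV[R[i]]_n) k 0)) by exact: mf.
  under eq_fun do rewrite mxE raddf_sum /=.
  apply: measurable_sum => j.
  have -> : (fun psi : borel_ket R n => complex.Im (U k j * (psi : 'cV[R[i]]_n) j 0)) =
      (fun psi : borel_ket R n => complex.Re (U k j) * complex.Im ((psi : 'cV[R[i]]_n) j 0)
         + complex.Im (U k j) * complex.Re ((psi : 'cV[R[i]]_n) j 0)).
    by apply/funext => psi; case: (U k j) => a b; case: (_ j 0).
  by apply: measurable_funD; apply: measurable_funM => //;
    [exact: measurable_coord_Im | exact: measurable_coord_Re].
Qed.

Lemma measurable_bloch m : measurable_fun setT (@bloch R m).
Proof.
have re k := @measurable_coord_Re 2 k; have im k := @measurable_coord_Im 2 k.
rewrite (funext (blochE m)).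
case: m => [[|[|[|[|//]]]] ?] /=;
  by do ?[apply: measurable_funB | apply: measurable_funD
         | apply: measurable_funM | exact: re | exact: im
         | exact: measurable_cst].
Qed.

Lemma measurable_sphere : measurable sphere.
Proof.
rewrite unit_sphere_bloch -[X in measurable X]setTI.
exact: (measurable_bloch ord0 measurableT (measurable_set1 (1 : R))).
Qed.

Lemma rotate_sphere n (U : 'M[R[i]]_n) :
  U \is unitarymx -> rotate U @^-1` (@unit_sphere R n) = @unit_sphere R n.
Proof.
move=> /unitarymxP /mulmx1C UU; apply/funext => psi; apply/propext.
rewrite /preimage /unit_sphere /= /bracket /rotate adjmx_mul.
by rewrite -mulmxA (mulmxA (U ^t*)) UU mul1mx.
Qed.

Variable mu : probability (borel_ket R 2) R.
Hypothesis hmu : uniform_on_sphere mu.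

(** Invariance says that [mu] agrees with its pushforward under [U] on measurable sets, and the
    sphere is its own preimage. The bound on [f] supplies the integrability required by the change
    of variables. *)
Lemma Rintegral_rotate (U : 'M[R[i]]_2) (f : borel_ket R 2 -> R) :
  U \is unitarymx -> measurable_fun setT f ->
  (forall psi, sphere psi -> `|f psi| <= 1) ->
  \int[mu]_(psi in sphere) f (rotate U psi) = \int[mu]_(psi in sphere) f psi.
Proof.
move=> uU mf f1; have mrot := measurable_rotate U.
pose muU : {measure set (borel_ket R 2) -> \bar R} :=
  measure_function_pushforward__canonical__measure_function_Measure mu mrot.
congr fine; symmetry.
rewrite (eq_measure_integral muU) => [|A mA _]; last first.
  by case: hmu => _ /(_ U uU A mA).
rewrite integral_pushforward //=; last 3 first.
- exact/measurable_EFinP.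
- rewrite rotate_sphere //; apply: measurable_bounded_integrable.
  + exact: measurable_sphere.
  + by rewrite (le_lt_trans (probability_le1 _ _)) ?ltry //; exact: measurable_sphere.
  + by apply: measurable_funTS; exact: measurableT_comp.
  + exists 1; split; first exact: num_real.
    move=> M M1 psi Spsi; apply: le_trans (ltW M1); apply: f1.
    by have := Spsi; rewrite -{1}(rotate_sphere uU).
- exact: measurable_sphere.
by rewrite rotate_sphere.
Qed.

(** This is the commutation table of the Pauli operators, that is, the character table of the Klein
    four-group; hence the orthogonality of its columns. *)
Definition pauli_sign (k m : 'I_4) : R :=
  nth 0 (nth [::] [:: [:: 1; 1; 1; 1];
                      [:: 1; 1; -1; -1];
                      [:: 1; -1; 1; -1];
                      [:: 1; -1; -1; 1]] k) m.

Lemma pauli_signE k m :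
  S k *m S m *m S k = (pauli_sign k m)%:C *: S m.
Proof.
case: (unliftP ord0 m) => [i ->|->].
  rewrite pauli_conj; congr ((_)%:C *: _); rewrite mxE.
  by case: k i => [[|[|[|[|//]]]] ?] [[|[|[|//]]] ?].
rewrite pauli0 mulmx1 pauli_sqr.
by case: k => [[|[|[|[|//]]]] ?]; rewrite /pauli_sign /= rmorph1 scale1r.
Qed.

Lemma pauli_sign_orthogonal m n :
  m != n -> \sum_k pauli_sign k m * pauli_sign k n = 0.
Proof.
rewrite -val_eqE !big_ord_recl big_ord0 /pauli_sign.
by case: m n => [[|[|[|[|//]]]] ?] [[|[|[|[|//]]]] ?] //= _; ring.
Qed.

(* (1 + i sigma_1 + i sigma_2 + i sigma_3) / 2, the rotation of the Bloch
   sphere by a third of a turn about the axis (1, 1, 1). *)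
Definition pauli_cycle : 'M[R[i]]_2 :=
  2^-1 *: mx2 (1 + 'i%C) (1 + 'i%C) ('i%C - 1) (1 - 'i%C).

Let adj_pauli_cycle : pauli_cycle ^t* =
  2^-1 *: mx2 (1 - 'i%C) (- 'i%C - 1) (1 - 'i%C) (1 + 'i%C).
Proof.
rewrite /pauli_cycle adjmxZ fmorphV rmorph_nat adj_mx2.
by rewrite !rmorphB rmorphD /= rmorph1 conj_i opprK.
Qed.

Lemma pauli_cycle_unitary : pauli_cycle \is unitarymx.
Proof.
apply/unitarymxP; rewrite adj_pauli_cycle /pauli_cycle mx2_1 !mx2E.
congr mx2; by field: (mulii R).
Qed.

Lemma pauli_cycle_conj (i : 'I_3) :
  pauli_cycle ^t* *m sigma i *m pauli_cycle = sigma (ordS i).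
Proof.
rewrite adj_pauli_cycle /pauli_cycle.
case: i => [[|[|[|//]]] ?]; rewrite /pauli /= !mx2E;
  congr mx2; by field: (mulii R).
Qed.

Lemma pauli_unitary m : S m \is unitarymx.
Proof. by apply/unitarymxP; rewrite pauli_herm pauli_sqr. Qed.

Definition moment m n : R := \int[mu]_(psi in sphere) (bloch m psi * bloch n psi).

Let bloch2_le1 m n psi : sphere psi -> `|bloch m psi * bloch n psi| <= 1.
Proof. by move=> Spsi; rewrite normrM mulr_ile1 // bloch_le1. Qed.

Let measurable_bloch2 m n :
  measurable_fun setT (fun psi => @bloch R m psi * bloch n psi).
Proof. by apply: measurable_funM; exact: measurable_bloch. Qed.

Lemma integrable_bloch2 m n :
  mu.-integrable sphere (EFin \o (fun psi => bloch m psi * bloch n psi)).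
Proof.
apply: measurable_bounded_integrable.
- exact: measurable_sphere.
- by rewrite (le_lt_trans (probability_le1 _ _)) ?ltry //; exact: measurable_sphere.
- by apply: measurable_funTS; exact: measurable_bloch2.
- exists 1; split; first exact: num_real.
  by move=> M M1 psi Spsi; apply: le_trans (ltW M1); apply: bloch2_le1.
Qed.

Lemma moment_unitary (U : 'M[R[i]]_2) m n m' n' (c c' : R) :
  U \is unitarymx ->
  U ^t* *m S m *m U = c%:C *: S m' -> U ^t* *m S n *m U = c'%:C *: S n' ->
  moment m n = c * c' * moment m' n'.
Proof.
move=> uU hm hn; rewrite /moment.
rewrite -(Rintegral_rotate uU (measurable_bloch2 m n) (bloch2_le1 m n)).
rewrite -RintegralZl; [|exact: measurable_sphere|exact: integrable_bloch2].
apply: eq_Rintegral => psi _; rewrite /rotate.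
by rewrite (bloch_unitary psi hm) (bloch_unitary psi hn); ring.
Qed.

(** Conjugation by [S k] multiplies the moment by a product of two signs; summing over the four
    values of k gives four times the moment on one side and 0 on the other. *)
Lemma moment_neq m n : m != n -> moment m n = 0.
Proof.
move=> nmn.
have flip k : moment m n = pauli_sign k m * pauli_sign k n * moment m n.
  by apply: (moment_unitary (pauli_unitary k)); rewrite pauli_herm pauli_signE.
have : \sum_(k < 4) moment m n = 0.
  under eq_bigr => k _ do rewrite (flip k).
  by rewrite -mulr_suml pauli_sign_orthogonal // mul0r.
by rewrite sumr_const card_ord => /eqP; rewrite mulrn_eq0 => /eqP.
Qed.

Lemma moment00 : moment ord0 ord0 = 1.
Proof.
transitivity (\int[mu]_(psi in sphere) (1 : R)).
  apply: eq_Rintegral => psi.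
  by rewrite unit_sphere_bloch inE /= => ->; rewrite mulr1.
rewrite Rintegral_cst; last exact: measurable_sphere.
by case: hmu => mu1 _; rewrite mul1r [X in fine X]mu1.
Qed.

(** The index type is kept general because the lemma is applied both to the three axes and to pairs
    of Pauli indices. *)
Lemma Rintegral_lincomb d (T : measurableType d) (nu : {measure set T -> \bar R})
    (D : set T) (J : Type) (r : seq J) (c : J -> R) (f : J -> T -> R) :
  measurable D -> (forall j, nu.-integrable D (EFin \o f j)) ->
  \int[nu]_(x in D) (\sum_(j <- r) c j * f j x) =
    \sum_(j <- r) c j * \int[nu]_(x in D) f j x.
Proof.
move=> mD intf.
have intcf j : nu.-integrable D (EFin \o (fun x => c j * f j x)).
  by have := integrableZl mD (c j) (intf j); apply: eq_integrable.
elim: r => [|j r IH].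
  under eq_Rintegral do rewrite big_nil.
  by rewrite big_nil Rintegral_cst // mul0r.
under eq_Rintegral do rewrite big_cons.
rewrite big_cons RintegralD //; first by rewrite RintegralZl // IH.
have := integrable_sum mD r (P := xpredT) (fun j _ => intcf j).
by apply: eq_integrable => // x _ /=; rewrite sumEFin.
Qed.

(** The cyclic rotation makes the three moments equal, and they sum to 1 since the Bloch vector of a
    unit vector has length 1. *)
Lemma moment_sigma i : moment (lift ord0 i) (lift ord0 i) = 3^-1.
Proof.
have cyc j : moment (lift ord0 j) (lift ord0 j) =
    moment (lift ord0 (ordS j)) (lift ord0 (ordS j)).
  rewrite -[RHS]mul1r -[1]mulr1.
  by apply: (moment_unitary pauli_cycle_unitary);
    rewrite rmorph1 scale1r pauli_cycle_conj.
pose v j := moment (lift ord0 j) (lift ord0 j); rewrite -/(v i).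
have {}cyc j : v j = v (ordS j) := cyc j.
have eqv j : v j = v ord0.
  have [->|[->|->]] : j = ord0 \/ j = ordS ord0 \/ j = ordS (ordS ord0).
  - case: j => [[|[|[|//]]] ?]; [left|right; left|right; right]; exact/val_inj.
  - exact: erefl.
  - exact: esym (cyc ord0).
  - exact: esym (etrans (cyc ord0) (cyc (ordS ord0))).
have : \sum_(j < 3) 1 * v j = 1.
  rewrite /v /moment -(Rintegral_lincomb _ _ measurable_sphere) => [|j]; last first.
    exact: integrable_bloch2.
  rewrite -[RHS]moment00; apply: eq_Rintegral => psi _.
  under eq_bigr do rewrite mul1r -expr2.
  by rewrite bloch_sqr_sum expr2.
under eq_bigr do rewrite mul1r eqv.
rewrite eqv sumr_const card_ord -mulr_natl => h.
by move: h; move: (v ord0) => x h; lra.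
Qed.

(** Only the diagonal of the quadratic form survives: the identity term has moment 1, and the others
    have moment 1/3, turning 1/4 into 1/12. *)
Lemma Rintegral_fidelity (E : superop R 2) : linear E ->
  \int[mu]_(psi in sphere)
     complex.Re (bracket psi (E (ketbra psi psi) *m psi)) =
  4^-1 * complex.Re (\tr (E 1%:M)) + 12^-1 * complex.Re (score E).
Proof.
move=> linE.
under eq_Rintegral => psi _ do rewrite fidelity_bloch // pair_big /=.
rewrite (Rintegral_lincomb _ _ measurable_sphere) => [|[m n]]; last first.
  exact: integrable_bloch2.
rewrite -(pair_bigA _ (fun m n =>
  4^-1 * complex.Re (\tr (S m *m E (S n))) * moment m n)) /=.
rewrite (eq_bigr (fun m =>
    4^-1 * complex.Re (\tr (S m *m E (S m))) * moment m m)) => [|m _]; last first.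
  rewrite (bigD1 m) //= big1 ?addr0 // => n nmn.
  by rewrite moment_neq ?mulr0 // eq_sym.
rewrite big_ord_recl moment00 mulr1 pauli0 mul1mx; congr (_ + _).
rewrite /score raddf_sum mulr_sumr; apply: eq_bigr => i _ /=.
by rewrite moment_sigma; field.
Qed.

End Moments.

(** * Fidelities of protocols and their upper bound *)

Section Protocols.
Variable R : realType.
Local Open Scope sesquilinear_scope.
Local Open Scope complex_scope.
Local Open Scope classical_set_scope.
Local Open Scope ring_scope.
Local Notation S m := (pauli R m).
Local Notation sigma i := (pauli R (lift ord0 i)).

Lemma tr_sum n (J : finType) (F : J -> 'M[R[i]]_n) :
  \tr (\sum_j F j) = \sum_j \tr (F j).
Proof. exact: raddf_sum. Qed.

Lemma ketbra_herm n (u : 'cV[R[i]]_n) : (ketbra u u) ^t* = ketbra u u.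
Proof. by rewrite /ketbra adjmx_mul adjmxK. Qed.

Lemma tr_ketbra n (u : 'cV[R[i]]_n) : \tr (ketbra u u) = bracket u u.
Proof. by rewrite /ketbra mxtrace_mulC /mxtrace big_ord1. Qed.

Lemma ketbra_sqr n (u : 'cV[R[i]]_n) :
  bracket u u = 1 -> ketbra u u *m ketbra u u = ketbra u u.
Proof.
move=> u1; rewrite /ketbra -mulmxA (mulmxA (u ^t*)).
have -> : u ^t* *m u = 1%:M.
  by apply/matrixP => a b; rewrite !ord1 [RHS]mxE eqxx.
by rewrite mul1mx.
Qed.

(** The matrix with the vectors as columns is square, so its left inverse is also a right
    inverse. *)
Lemma sum_ketbra n (phi : 'I_n -> 'cV[R[i]]_n) :
  orthonormal_basis phi -> \sum_w ketbra (phi w) (phi w) = 1%:M.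
Proof.
move=> onb; pose F : 'M[R[i]]_n := \matrix_(a, b) phi b a 0.
have FF : F ^t* *m F = 1%:M.
  apply/matrixP => a b; rewrite [RHS]mxE -(onb a b) /bracket !mxE.
  by apply: eq_bigr => k _; rewrite !mxE.
rewrite -(mulmx1C FF); apply/matrixP => a b; rewrite summxE mxE.
by apply: eq_bigr => w _; rewrite !mxE big_ord1 !mxE.
Qed.

(** The Kraus operators are the products of [u] with the dual standard basis vectors. *)
Lemma cp_trace_ketbra n (u : 'cV[R[i]]_n) :
  completely_positive (fun rho => \tr rho *: ketbra u u).
Proof.
have := cp_sum (fun j : 'I_n => cp_kraus (u *m (delta_mx 0 j : 'rV[R[i]]_n))).
apply: cp_ext => rho /=.
under eq_bigr => j _.
  rewrite adjmx_mul -!mulmxA (mulmxA (delta_mx 0 j)) -rowE.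
  have -> : row j rho *m ((delta_mx 0 j : 'rV[R[i]]_n) ^t* *m u ^t*) =
      rho j j *: u ^t*.
    rewrite mulmxA.
    have -> : row j rho *m (delta_mx 0 j : 'rV[R[i]]_n) ^t* = (rho j j)%:M.
      apply/matrixP => a b; rewrite !ord1 !mxE (bigD1 j) //= big1 => [|k nkj].
        by rewrite !mxE !eqxx rmorph1 mulr1 addr0.
      by rewrite !mxE (negPf nkj) andbF rmorph0 mulr0.
    by rewrite mul_scalar_mx.
  rewrite -scalemxAr.
  over.
by rewrite -scaler_suml.
Qed.

Lemma no_measurement_protocol m : is_protocol (no_measurement (S m)).
Proof.
split=> [w | rho | w] /=.
- by apply: cp_ext (cp_kraus (1%:M : 'M[R[i]]_2)) => X;
    rewrite adjmx1 mul1mx mulmx1.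
- by rewrite sumr_const card_unit.
split=> [rho|].
  by rewrite -mulmxA mxtrace_mulC -mulmxA pauli_sqr mulmx1.
by apply: cp_ext (cp_kraus (S m)) => X; rewrite pauli_herm.
Qed.

Lemma discriminate_reprepare_protocol n (phi : 'I_n -> 'cV[R[i]]_n) :
  orthonormal_basis phi -> is_protocol (discriminate_reprepare phi).
Proof.
move=> onb; have phi1 w : bracket (phi w) (phi w) = 1 by rewrite onb eqxx.
split=> [w | rho | w] /=.
- by apply: cp_ext (cp_kraus (ketbra (phi w) (phi w))) => X; rewrite ketbra_herm.
- rewrite tr_sum; under eq_bigr => w _ do
    rewrite -mulmxA mxtrace_mulC -mulmxA ketbra_sqr // mxtrace_mulC.
  by rewrite -tr_sum -mulmx_suml sum_ketbra // mul1mx.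
split=> [rho|]; first by rewrite mxtraceZ tr_ketbra phi1 mulr1.
exact: cp_trace_ketbra.
Qed.

Variable mu : probability (borel_ket R 2) R.
Hypothesis hmu : uniform_on_sphere mu.
Variables (N : superop R 2) (d : 'rV[R]_3).
Hypotheses (tpcpN : tpcp N) (unitalN : unital N) (diagN : pauli_diagonal N d).

Let linN : linear N. Proof. by case: tpcpN => _ []. Qed.

(** The average operation preserves the trace, so its value at 1 has trace 2 and contributes 2/4. *)
Lemma average_fidelityE (Q : control R 2) : is_protocol Q ->
  average_fidelity mu N Q =
  1 / 2 + 12^-1 * complex.Re (\sum_w score
    (fun X => @ex_post R 2 Q w (N (@ex_ante R 2 Q w X)))).
Proof.
case=> cpI trI tpcpC.
have linE : linear (average_operation N Q).
  move=> a X Y; rewrite /average_operation scaler_sumr -big_split.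
  apply: eq_bigr => w _ /=; have [linI _] := cpI w.
  by have [_ [linC _]] := tpcpC w; rewrite linI linN linC.
rewrite /average_fidelity (Rintegral_fidelity hmu linE); congr (_ + _ * _).
  rewrite /average_operation tr_sum.
  under eq_bigr => w _ do rewrite (tpcpC w).1 (tpcpN.1).
  by rewrite -tr_sum trI mxtrace1 /=; lra.
congr complex.Re; rewrite /score [RHS]exchange_big; apply: eq_bigr => i _ /=.
by rewrite /average_operation mulmx_sumr tr_sum.
Qed.

(** The traces of the instrument at 1 add up to 2 over the outcomes, so the score is at most twice
    the weighted mean of the [c j], and 2/12 = 1/6. *)
Lemma average_fidelity_le (Q : control R 2) k (v : 'I_k -> 'rV[R]_3)
    (a c : 'I_k -> R) :
  is_protocol Q -> (forall j, 0 <= a j) -> \sum_j a j = 1 ->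
  d = \sum_j a j *: v j ->
  (forall C I j, tpcp C -> completely_positive I ->
     score (fun X => C (pauli_map (v j) (I X))) <= (c j)%:C * \tr (I 1%:M)) ->
  average_fidelity mu N Q <= 1 / 2 + (\sum_j a j * c j) / 6.
Proof.
move=> protQ a0 a1 dE bound; rewrite average_fidelityE // lerD2l.
case: protQ => cpI trI tpcpC.
rewrite (funext (pauli_mapE linN unitalN diagN)) dE.
have : \sum_w score (fun X => @ex_post R 2 Q w
      (pauli_map (\sum_j a j *: v j) (@ex_ante R 2 Q w X)))
    <= (\sum_j a j * c j)%:C * 2.
  have <- : \tr (\sum_w @ex_ante R 2 Q w 1%:M) = 2 by rewrite trI mxtrace1.
  rewrite tr_sum mulr_sumr; apply: ler_sum => w _.
  exact: (score_conv_le (tpcpC w) a0 a1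
            (fun j => bound _ _ j (tpcpC w) (cpI w))).
(* An inequality in [R[i]] also asserts equality of imaginary parts; only its real half is kept. *)
rewrite lecE Re_realM => /andP[_]; set s := complex.Re _; set t := \sum_j _.
by move=> /= le_st; lra.
Qed.

Lemma no_measurement_fidelity m :
  average_fidelity mu N (no_measurement (S m)) = 1 / 2 + dot (vertex R m) d / 6.
Proof.
rewrite average_fidelityE; last exact: no_measurement_protocol.
rewrite /= sumr_const card_unit mulr1n; congr (_ + _).
have -> : score (fun X => S m *m N X *m S m) = (2 * dot (vertex R m) d)%:C.
  rewrite /score /dot mulr_sumr rmorph_sum; apply: eq_bigr => i _.
  rewrite diagN -scalemxAr -scalemxAl pauli_conj scalerA -scalemxAr mxtraceZ.
  by rewrite pauli_sqr mxtrace1 !rmorphM rmorph_nat; ring.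
by rewrite /=; field.
Qed.

(** The noise enters only through its trace, and each outcome, with projector P, contributes tr(P
    (2P - 1)) = 1 to the score; hence 1/2 + 2/12. *)
Lemma discriminate_reprepare_fidelity (phi : 'I_2 -> 'cV[R[i]]_2) :
  orthonormal_basis phi ->
  average_fidelity mu N (discriminate_reprepare phi) = 2 / 3.
Proof.
move=> onb; rewrite average_fidelityE; last exact: discriminate_reprepare_protocol.
rewrite /= (eq_bigr (fun=> 1)) => [|w _]; last first.
  set P := ketbra (phi w) (phi w).
  have trP : \tr P = 1 by rewrite tr_ketbra onb eqxx.
  have PP : P *m P = P by rewrite ketbra_sqr // onb eqxx.
  transitivity (\tr (P *m \sum_i \tr (sigma i *m P) *: sigma i)).
    rewrite mulmx_sumr tr_sum; apply: eq_bigr => i _.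
    rewrite !tr_mulZ tpcpN.1 mulrC; congr (_ * _).
    by rewrite mxtrace_mulC mulmxA PP.
  by rewrite sigma_expansion trP scale1r tr_mulBr tr_mulZ PP mulmx1 trP; ring.
by rewrite sumr_const card_ord /=; field.
Qed.

End Protocols.

Theorem theorem2 (R : realType) (mu : probability (borel_ket R 2) R)
    (hmu : uniform_on_sphere mu)
    (N : superop R 2) (d : 'rV[R]_3)
    (hN : tpcp N) (hN1 : unital N) (hNd : pauli_diagonal N d)
    (hd : tetrahedron d) :
  (forall m : 'I_4, corner m d ->
     optimal mu N (no_measurement (pauli R m)) /\
     optimal_average_fidelity mu N (1 / 2 + (\sum_(i < 3) `|d 0 i|) / 6)) /\
  (octahedron d ->
     (forall phi : 'I_2 -> 'cV[R[i]]_2, orthonormal_basis phi ->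
        optimal mu N (discriminate_reprepare phi)) /\
     optimal_average_fidelity mu N (2 / 3)).
Proof.
split=> [m md | dO].
  have protP := no_measurement_protocol R m.
  have fidP := no_measurement_fidelity hmu hN hNd m.
  have maxP Q : is_protocol Q ->
      average_fidelity mu N Q <= 1 / 2 + dot (vertex R m) d / 6.
    move=> protQ; case: md => k [v [a [vS a0 a1 dE]]].
    (* The bound becomes a weighted mean of [dot (vertex R m) (v j)], so these values play the role
       of the constants [c j]. *)
    rewrite dE dot_conv.
    apply: (average_fidelity_le hmu hN hN1 hNd protQ a0 a1 dE) => C I j tC cI.
    case: (vS j) => [->|[m' [nm'm ->]]].
      by rewrite vertex_dot rmorph_nat; exact: score_vertex.
    rewrite vertex_dot_midpoint // rmorph1 mul1r.
    by apply: score_midpoint => //; rewrite eq_sym.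
  rewrite -(corner_dot md); split.
    by split=> [|Q protQ]; [exact: protP | rewrite fidP; exact: maxP].
  by split; [exists (no_measurement (pauli R m)) | exact: maxP].
have maxP Q : is_protocol Q -> average_fidelity mu N Q <= 2 / 3.
  move=> protQ; case: dO => k [v [a [vS a0 a1 dE]]].
  (* All points are midpoints, so every [c j] is 1; the value is rewritten to display that weighted
     mean. *)
  have -> : 2 / 3 = 1 / 2 + (\sum_j a j * 1) / 6 :> R.
    by under eq_bigr do rewrite mulr1; rewrite a1; field.
  apply: (average_fidelity_le hmu hN hN1 hNd protQ a0 a1 dE) => C I j tC cI.
  case: (vS j) => m [m' [nmm' ->]].
  by rewrite rmorph1 mul1r; exact: score_midpoint.
have optP phi : orthonormal_basis phi -> optimal mu N (discriminate_reprepare phi).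
  move=> onb; split; first exact: discriminate_reprepare_protocol.
  by move=> Q protQ; rewrite (discriminate_reprepare_fidelity hmu hN onb); exact: maxP.
split; first exact: optP.
split; last exact: maxP.
(* Attainment of the value needs one concrete orthonormal basis, here the standard one. *)
pose e (i : 'I_2) : 'cV[R[i]]_2 := delta_mx i 0.
have onb : orthonormal_basis e.
  move=> i j; rewrite /bracket mxE (bigD1 i) //= big1 => [|k nki].
    by rewrite !mxE !eqxx rmorph1 mul1r addr0 andbT.
  by rewrite !mxE (negPf nki) rmorph0 mul0r.
exists (discriminate_reprepare e); first exact: discriminate_reprepare_protocol.
exact: (discriminate_reprepare_fidelity hmu hN onb).
Qed.
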